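(* Let $p\in\{1,\dots,n\}$. If $f\colon\mathbb{B}^n\to\mathbb{R}$ is $p$-locally monotone, then it has $p$-permutable lattice derivatives.
   Context: $\mathbb{B}=\{0,1\}$, $[n]=\{1,\dots,n\}$. For $k\in[n]$, $\mathbf{x}\in\mathbb{B}^n$, $a\in\mathbb{B}$, $\mathbf{x}_k^a$ is the tuple obtained from $\mathbf{x}$ by replacing its $k$-th component by $a$; $\Delta_kf(\mathbf{x})=f(\mathbf{x}_k^1)-f(\mathbf{x}_k^0)$. The function $f$ is $p$-locally monotone if for every $k\in[n]$ and all $\mathbf{x},\mathbf{y}\in\mathbb{B}^n$ with $\sum_{i\in[n]\setminus\{k\}}|x_i-y_i|<p$ we have $\Delta_kf(\mathbf{x})\,\Delta_kf(\mathbf{y})\geq 0$. The lattice derivatives are $\wedge_kf,\vee_kf\colon\mathbb{B}^n\to\mathbb{R}$, $\wedge_kf(\mathbf{x})=\min(f(\mathbf{x}_k^0),f(\mathbf{x}_k^1))$, $\vee_kf(\mathbf{x})=\max(f(\mathbf{x}_k^0),f(\mathbf{x}_k^1))$. The function $f$ has $p$-permutable lattice derivatives if for every $p$-subset $\{k_1,\dots,k_p\}\subseteq[n]$, every choice of operators $O_{k_i}\in\{\wedge_{k_i},\vee_{k_i}\}$ ($i=1,\dots,p$) and every permutation $\pi$ of $\{1,\dots,p\}$, we have $O_{k_1}\cdots O_{k_p}f=O_{k_{\pi(1)}}\cdots O_{k_{\pi(p)}}f$ (operators applied right to left). *)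

(* Defs.v *)
From mathcomp Require Import all_boot all_order all_fingroup all_algebra.
From mathcomp Require Import reals.

Set Implicit Arguments.
Unset Strict Implicit.
Unset Printing Implicit Defensive.

Import Order.TTheory GRing.Theory Num.Theory.

Local Open Scope ring_scope.

(* Components are indexed by 'I_n = {0, ..., n-1} in place of {1, ..., n}. *)
Definition cube (n : nat) := {ffun 'I_n -> bool}.

Definition setc (n : nat) (x : cube n) (k : 'I_n) (a : bool) : cube n :=
  [ffun i => if i == k then a else x i].

Definition pderiv (R : realType) (n : nat) (k : 'I_n) (f : cube n -> R) :
    cube n -> R :=
  fun x => f (setc x k true) - f (setc x k false).

Definition locally_monotone (R : realType) (n p : nat) (f : cube n -> R) :
    Prop :=
  forall (k : 'I_n) (x y : cube n),
    (\sum_(i < n | i != k) `|(x i : nat) - (y i : nat)| < p)%N ->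
    0 <= pderiv k f x * pderiv k f y.

Definition meet_deriv (R : realType) (n : nat) (k : 'I_n) (f : cube n -> R) :
    cube n -> R :=
  fun x => Num.min (f (setc x k false)) (f (setc x k true)).

Definition join_deriv (R : realType) (n : nat) (k : 'I_n) (f : cube n -> R) :
    cube n -> R :=
  fun x => Num.max (f (setc x k false)) (f (setc x k true)).

(* The first operator of the list is the outermost one:
   compose_ops [:: O1; ...; Op] f = O1 (... (Op f)). *)
Definition compose_ops (T : Type) (ops : seq (T -> T)) (f : T) : T :=
  foldr (fun O g => O g) f ops.

(* A p-subset is given by an injective enumeration k of its elements. *)
Definition permutable_lattice_derivatives (R : realType) (n p : nat)
    (f : cube n -> R) : Prop :=
  forall (k : 'I_p -> 'I_n) (O : 'I_p -> (cube n -> R) -> (cube n -> R))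
         (s : {perm 'I_p}),
    injective k ->
    (forall i, O i = meet_deriv (k i) \/ O i = join_deriv (k i)) ->
    compose_ops [seq O i | i <- enum 'I_p] f
      =1 compose_ops [seq O (s i) | i <- enum 'I_p] f.

(* Main.v *)
(* A lattice derivative of a (p+1)-locally monotone function is p-locally
   monotone, and on a 2-locally monotone function the lattice derivatives with
   respect to two distinct components commute, because every two-dimensional
   face is monotone up to reversing components. In a composition of p
   operators, any two adjacent ones are applied to a function obtained by at
   most p-2 operators, which is thus still 2-locally monotone, so they may be
   exchanged. *)
Require Import Defs.
From mathcomp Require Import all_boot all_order all_fingroup all_algebra.
From mathcomp Require Import boolp reals lra.

Set Implicit Arguments.
Unset Strict Implicit.
Unset Printing Implicit Defensive.

Import Order.TTheory GRing.Theory Num.Theory.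

Local Open Scope ring_scope.

Section Cube.

Variable n : nat.
Implicit Types (x y : cube n) (j k : 'I_n) (a b : bool).

Lemma setcC x j k a b :
  j != k -> setc (setc x j a) k b = setc (setc x k b) j a.
Proof.
move=> njk; apply/ffunP => i; rewrite !ffunE.
by case: (eqVneq i k) => [->|//]; rewrite eq_sym (negbTE njk).
Qed.

Lemma setcK x k a b : setc (setc x k a) k b = setc x k b.
Proof. by apply/ffunP => i; rewrite !ffunE; case: eqP. Qed.

(** Only the summand at [k] can change, and it is at most 1; for [k = j] it is left out of the
    sum. *)
Lemma dist_setc j k x y a b :
  (\sum_(i < n | i != j) `|(setc x k a i : nat) - (setc y k b i : nat)| <=
   (\sum_(i < n | i != j) `|(x i : nat) - (y i : nat)|).+1)%N.
Proof.
have [->|nkj] := eqVneq k j.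
  apply: leqW; apply: leq_sum => i nij.
  by rewrite !ffunE (negbTE nij).
rewrite (bigD1 k) //= [X in (_ <= X.+1)%N](bigD1 k) //= -add1n leq_add //.
  by rewrite !ffunE eqxx; case: a; case: b.
apply: leq_trans (leq_addl _ _); apply: leq_sum => i /andP[_ nik].
by rewrite !ffunE (negbTE nik).
Qed.

End Cube.

Section LatticeDerivatives.

Variables (R : realType) (n : nat).
Implicit Types (f : cube n -> R) (j k : 'I_n).

Definition lattice_deriv k (D : (cube n -> R) -> cube n -> R) :=
  D = meet_deriv k \/ D = join_deriv k.

(** One strictly negative value forces all the others to be nonpositive. *)
Lemma constant_sign (T : Type) (u : T -> R) :
  (forall s t, 0 <= u s * u t) ->
  (forall t, 0 <= u t) \/ (forall t, u t <= 0).
Proof.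
move=> uu; have [[s us]|nneg] := pselect (exists s, u s < 0).
  by right => t; rewrite -(nmulr_rge0 _ us).
by left => t; rewrite leNgt; apply/negP => ut; apply: nneg; exists t.
Qed.

(** This holds because [min] and [max] are monotone in both arguments. *)
Lemma pderiv_lattice_deriv_ge0 j k D f (x : cube n) :
  k != j -> lattice_deriv k D ->
  (forall a, 0 <= pderiv j f (setc x k a)) -> 0 <= pderiv j (D f) x.
Proof.
move=> nkj HD dge0; have := (dge0 false, dge0 true).
rewrite /pderiv !subr_ge0 => -[f0 f1].
case: HD => ->; rewrite /meet_deriv /join_deriv -!(setcC x _ _ nkj).
  by rewrite le_min !ge_min f0 f1 orbT.
by rewrite ge_max !le_max f0 f1 orbT.
Qed.

Lemma pderiv_lattice_deriv_le0 j k D f (x : cube n) :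
  k != j -> lattice_deriv k D ->
  (forall a, pderiv j f (setc x k a) <= 0) -> pderiv j (D f) x <= 0.
Proof.
move=> nkj HD dle0; have := (dle0 false, dle0 true).
rewrite /pderiv !subr_le0 => -[f0 f1].
case: HD => ->; rewrite /meet_deriv /join_deriv -!(setcC x _ _ nkj).
  by rewrite le_min !ge_min f0 f1 orbT.
by rewrite ge_max !le_max f0 f1 orbT.
Qed.

Lemma lattice_deriv_locally_monotone p k D f :
  lattice_deriv k D -> locally_monotone p.+1 f -> locally_monotone p (D f).
Proof.
move=> HD fmon j x y xy; have [<-{j xy}|nkj] := eqVneq k j.
  (* [D f] does not depend on component [k], so its derivative there vanishes. *)
  by case: HD => ->; rewrite /pderiv /meet_deriv /join_deriv !setcK subrr mul0r.
pose z (c : bool) := if c then x else y.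
have zz c c' : (\sum_(i < n | i != j) `|(z c i : nat) - (z c' i : nat)| < p)%N.
  case: c; case: c' => //=.
  - by rewrite big1 ?(leq_ltn_trans _ xy) // => i _; rewrite distnn.
  - by under eq_bigr do rewrite distnC.
  - by rewrite big1 ?(leq_ltn_trans _ xy) // => i _; rewrite distnn.
(* The four points obtained from [x] and [y] by setting component [k] are pairwise at distance less
   than [p.+1] off [j], so the derivatives of [f] there share one sign, which [D f] inherits at [x]
   and [y]. *)
have [s t|d|d] :=
    @constant_sign (bool * bool)%type (fun t => pderiv j f (setc (z t.1) k t.2)).
- by apply: fmon; apply: leq_ltn_trans (dist_setc _ _ _ _ _ _) _; apply: zz.
- apply: mulr_ge0; apply: pderiv_lattice_deriv_ge0 nkj HD _ => a.
    exact: (d (true, a)).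
  exact: (d (false, a)).
- apply: mulr_le0; apply: pderiv_lattice_deriv_le0 nkj HD _ => a.
    exact: (d (true, a)).
  exact: (d (false, a)).
Qed.

Lemma same_sign (u v : R) :
  0 <= u * v -> (0 <= u /\ 0 <= v) \/ (u <= 0 /\ v <= 0).
Proof.
move=> uv; case: (lerP 0 u) => hu; case: (lerP 0 v) => hv; nra.
Qed.

(** The four values sit on a two-dimensional face whose opposite edges do not point in opposite
    directions. Both sides are invariant under reversing either component; if the face is increasing
    in both, both sides equal [b]. *)
Lemma meet_joinC (a b c d : R) :
  0 <= (b - a) * (d - c) -> 0 <= (c - a) * (d - b) ->
  Num.min (Num.max a b) (Num.max c d) = Num.max (Num.min a c) (Num.min b d).
Proof.
move=> /same_sign h1 /same_sign h2.
case: (lerP a b) => ?; case: (lerP c d) => ?;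
case: (lerP a c) => ?; case: (lerP b d) => ?;
by rewrite ?minEle ?maxEle; repeat case: ifPn; rewrite -?ltNge => *; lra.
Qed.

Lemma lattice_derivC j k D E f :
  j != k -> lattice_deriv j D -> lattice_deriv k E -> locally_monotone 2 f ->
  D (E f) =1 E (D f).
Proof.
move=> njk HD HE fmon x.
(* Opposite edges of the face are at distance at most 1, hence less than 2. Only the mixed meet-join
   cases use this. *)
have near i l : 0 <= pderiv i f (setc x l false) * pderiv i f (setc x l true).
  apply: fmon; apply: leq_ltn_trans (dist_setc _ _ _ _ _ _) _.
  by rewrite big1 // => m _; rewrite distnn.
case: HD => ->; case: HE => ->.
all: have := near j k; have := near k j.
all: rewrite /pderiv /meet_deriv /join_deriv !(setcC x _ _ njk).
- by rewrite minACA.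
- exact: meet_joinC.
- by move=> *; rewrite -meet_joinC.
- by rewrite maxACA.
Qed.

Section Compositions.

Variables (I : eqType) (k : I -> 'I_n).
Variable D : I -> (cube n -> R) -> cube n -> R.
Hypotheses (k_inj : injective k) (Dk : forall i, lattice_deriv (k i) (D i)).

Lemma compose_locally_monotone p (s : seq I) f :
  locally_monotone (size s + p) f ->
  locally_monotone p (compose_ops (map D s) f).
Proof.
elim: s p => [|i s IH] p //= fmon.
apply: (lattice_deriv_locally_monotone (Dk i)); apply: IH.
by rewrite addnS.
Qed.

Lemma locally_monotone_leq p q f :
  (p <= q)%N -> locally_monotone q f -> locally_monotone p f.
Proof. by move=> pq fmon k' x y xy; apply: fmon; apply: leq_trans xy pq. Qed.

Lemma compose_cons_cat (i : I) (s t : seq I) f :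
  i \notin s -> locally_monotone (size (i :: s ++ t)) f ->
  compose_ops (map D (i :: s ++ t)) f = compose_ops (map D (s ++ i :: t)) f.
Proof.
elim: s => [|l s IH] //=; rewrite inE negb_or => /andP[nil nis] fmon.
(* Inside [D l], the induction hypothesis pulls [D i] back in front of [s]; what remains is to
   exchange the two outermost operators. The [size (s ++ t)] operators below them leave 2-local
   monotonicity. *)
rewrite -[in RHS]IH //=; last exact: locally_monotone_leq fmon.
apply: funext; apply: (lattice_derivC _ (Dk i) (Dk l)).
  by rewrite (inj_eq k_inj).
by apply: compose_locally_monotone; rewrite addn2.
Qed.

(** Sorting by insertion: the tail of [s] is rearranged into [t] without the head [i], then [i] is
    moved inwards to its place in [t]. *)
Lemma compose_perm (s t : seq I) f :
  uniq s -> perm_eq s t -> locally_monotone (size s) f ->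
  compose_ops (map D s) f = compose_ops (map D t) f.
Proof.
elim: s t => [|i s IH] t /=; first by rewrite perm_sym => _ /perm_nilP ->.
move=> /andP[nis us] st fmon.
have it : i \in t by rewrite -(perm_mem st) mem_head.
case/splitPr: it st => t1 t2.
rewrite perm_sym perm_catC /= perm_cons perm_catC perm_sym => st.
rewrite (IH _ us st); last exact: locally_monotone_leq fmon.
apply: compose_cons_cat; last by rewrite /= -(perm_size st).
by move: nis; rewrite (perm_mem st) mem_cat; case/norP.
Qed.

End Compositions.

End LatticeDerivatives.

Theorem theorem21 (R : realType) (n p : nat) (f : cube n -> R) :
  (1 <= p)%N -> (p <= n)%N ->
  locally_monotone p f -> permutable_lattice_derivatives p f.
Proof.
move=> _ _ fmon k O s k_inj Ok x.
rewrite (map_comp O s).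
(* Both lists enumerate ['I_p] without repetition, and their length [p] is exactly the available
   order of local monotonicity. *)
rewrite (@compose_perm R n _ k O k_inj Ok _ [seq s i | i <- enum 'I_p]) //.
- exact: enum_uniq.
- apply: uniq_perm; rewrite ?(map_inj_uniq (@perm_inj _ s)) ?enum_uniq // => i.
  rewrite mem_enum; apply/esym/mapP; exists (s^-1 i)%g; rewrite ?mem_enum //.
  by rewrite permKV.
- by rewrite size_enum_ord.
Qed.
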